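(* Let $m\ge 2$, $n\ge 1$ and $\mathcal{A}\in T_{m,n}$. If $\mathcal{A}$ is strictly semi-positive, then $\mathcal{A}$ is a Q-tensor; likewise, if $\mathcal{A}$ is a P-tensor, then $\mathcal{A}$ is a Q-tensor. That is, the tensor complementarity problem $(\mathbf{q},\mathcal{A})$ has a solution for all $\mathbf{q}\in\mathbb{R}^n$ if $\mathcal{A}$ is either a P-tensor or a strictly semi-positive tensor.
   Context: $T_{m,n}$ is the set of real $m$th order $n$-dimensional tensors $\mathcal{A}=(a_{i_1\cdots i_m})$, with real entries indexed by $i_1,\ldots,i_m\in I_n:=\{1,\ldots,n\}$ (no symmetry assumed). For $\mathbf{x}\in\mathbb{R}^n$, $\mathcal{A}\mathbf{x}^{m-1}\in\mathbb{R}^n$ is the vector with components $(\mathcal{A}\mathbf{x}^{m-1})_i=\sum_{i_2,\ldots,i_m=1}^n a_{ii_2\cdots i_m}x_{i_2}\cdots x_{i_m}$. Vector inequalities are componentwise. Tensor complementarity problem $(\mathbf{q},\mathcal{A})$, for $\mathbf{q}\in\mathbb{R}^n$: find $\mathbf{x}\in\mathbb{R}^n$ such that $\mathbf{x}\ge\mathbf{0}$, $\mathbf{q}+\mathcal{A}\mathbf{x}^{m-1}\ge\mathbf{0}$ and $\mathbf{x}^\top(\mathbf{q}+\mathcal{A}\mathbf{x}^{m-1})=0$. $\mathcal{A}$ is a Q-tensor iff $(\mathbf{q},\mathcal{A})$ has a solution for every $\mathbf{q}\in\mathbb{R}^n$. $\mathcal{A}$ is strictly semi-positive iff for each $\mathbf{x}\in\mathbb{R}^n$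 with $\mathbf{x}\ge\mathbf{0}$, $\mathbf{x}\ne\mathbf{0}$, there is $k\in I_n$ with $x_k>0$ and $(\mathcal{A}\mathbf{x}^{m-1})_k>0$. $\mathcal{A}$ is a P-tensor iff for each $\mathbf{x}\in\mathbb{R}^n$ with $\mathbf{x}\neq\mathbf{0}$ there is $i\in I_n$ with $x_i(\mathcal{A}\mathbf{x}^{m-1})_i>0$. *)

(* Defs.v *)
From HB Require Import structures.
From mathcomp Require Import all_boot all_order all_algebra.
From mathcomp Require Import reals.

Set Implicit Arguments.
Unset Strict Implicit.
Unset Printing Implicit Defensive.

Import Order.TTheory GRing.Theory Num.Theory.
Local Open Scope ring_scope.

(* The multi-index (i_1, ..., i_m) is an m-tuple; indices run over
   {0, ..., n-1} instead of {1, ..., n}. *)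
Definition tensor (R : realType) (m n : nat) := {ffun m.-tuple 'I_n -> R}.

(* The i-th component of A x^{m-1}.  Summing over i_2, ..., i_m with i_1 = i
   is expressed as summing over the m-tuples whose head is i, so that the
   order m need not be a syntactic successor; see [tensor_apply_consE]. *)
Definition tensor_apply (R : realType) (m n : nat) (A : tensor R m n)
    (x : 'cV[R]_n) : 'cV[R]_n :=
  \col_i \sum_(t : m.-tuple 'I_n | ohead t == Some i)
            A t * \prod_(j <- behead t) x j 0.

Definition vec_ge0 (R : realType) (n : nat) (x : 'cV[R]_n) : Prop :=
  forall i, 0 <= x i 0.

Definition tcp_solution (R : realType) (m n : nat) (q : 'cV[R]_n)
    (A : tensor R m n) (x : 'cV[R]_n) : Prop :=
  [/\ vec_ge0 x,
      vec_ge0 (q + tensor_apply A x) &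
      x^T *m (q + tensor_apply A x) = 0].

Definition Q_tensor (R : realType) (m n : nat) (A : tensor R m n) : Prop :=
  forall q : 'cV[R]_n, exists x : 'cV[R]_n, tcp_solution q A x.

Definition strictly_semi_positive (R : realType) (m n : nat)
    (A : tensor R m n) : Prop :=
  forall x : 'cV[R]_n, vec_ge0 x -> x <> 0 ->
    exists k : 'I_n, 0 < x k 0 /\ 0 < tensor_apply A x k 0.

Definition P_tensor (R : realType) (m n : nat) (A : tensor R m n) : Prop :=
  forall x : 'cV[R]_n, x <> 0 ->
    exists i : 'I_n, 0 < x i 0 * tensor_apply A x i 0.

Lemma tensor_apply_consE (R : realType) (m n : nat) (A : tensor R m.+1 n)
    (x : 'cV[R]_n) (i : 'I_n) :
  tensor_apply A x i 0 =
  \sum_(t : m.-tuple 'I_n) A [tuple of i :: t] * \prod_(k < m) x (tnth t k) 0.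
Proof.
rewrite mxE (reindex_onto (fun t : m.-tuple 'I_n => [tuple of i :: t])
                          (fun t => [tuple of behead t])) /=; last first.
  by move=> t; case/tupleP: t => j t /= /eqP[->]; apply: val_inj.
apply: eq_big => [t|t _]; last by rewrite big_tuple.
by rewrite eqxx /=; apply/eqP/val_inj.
Qed.

(* Main.v *)
(* Both statements reduce to strictly semi-positive tensors.  Write
   F(x) = q + A x^{m-1}.  For every r > 0 the variational inequality for F on
   the simplex {x >= 0, sum x <= r} has a solution; it solves the
   complementarity problem unless sum x = r, and then F_k(x) <= 0 whenever
   x_k > 0.  If this happened for every r, rescaling to the unit simplex and
   letting r go to infinity would give p >= 0, p <> 0, with (A p^{m-1})_k <= 0
   for all k such that p_k > 0, contradicting strict semi-positivity.

   The variational inequality is obtained without Brouwer's theorem: label each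
   point x of a grid on the simplex by an index i minimising F_i(x) and apply
   Scarf's lemma to the coordinate orders.  It yields nearby grid points whose
   labels include every i for which x_i is not small; let the mesh go to 0. *)

Require Import Defs.
From HB Require Import structures.
From mathcomp Require Import boolp classical_sets topology normedtype sequences.
From mathcomp Require Import all_boot all_order all_algebra.
From mathcomp Require Import reals.

Set Implicit Arguments.
Unset Strict Implicit.
Unset Printing Implicit Defensive.

(** * Scarf's lemma *)

(** Dominance in Scarf's sense: no [y] lies strictly above the minimum of [S] in every order at
    once. *)
Definition dominant (T K : finType) (r : K -> T -> nat) (S : {set T}) : bool :=
  [forall y, exists i, forall (x | x \in S), r i y <= r i x].

Lemma dominantP (T K : finType) (r : K -> T -> nat) (S : {set T}) :
  reflect (forall y, exists i, forall x, x \in S -> r i y <= r i x)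
          (dominant r S).
Proof.
apply: (iffP forallP) => H y; have := H y.
  by move/existsP => [i /forall_inP Hi]; exists i.
by move=> [i Hi]; apply/existsP; exists i; apply/forall_inP.
Qed.

Lemma dominantS (T K : finType) (r : K -> T -> nat) (S S' : {set T}) :
  S \subset S' -> dominant r S' -> dominant r S.
Proof.
move=> /subsetP sSS' /dominantP H; apply/dominantP => y.
by have [i Hi] := H y; exists i => x /sSS'; apply: Hi.
Qed.

(** [K] has one element more than [P], so two colours collide; injectivity away from [j] then forces
    [j] to be one of these two. *)
Lemma surjection_collision (K T : finType) (f : K -> T) (P : {set T}) :
    f @: setT = P -> #|P|.+1 = #|K| ->
  exists i1 i2, [/\ i1 != i2, f i1 = f i2 &
    forall j, {in [set~ j] &, injective f} -> j = i1 \/ j = i2].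
Proof.
move=> fP cP.
have /injectivePn[i1 [i2 n12 e12]] : ~~ injectiveb f.
  apply/negP => /injectiveP f_inj.
  by move: cP; rewrite -fP card_imset // cardsT => /eqP; rewrite eqn_leq ltnn.
exists i1, i2; split=> // j f_inj.
have [->|n1] := eqVneq j i1; first by left.
have [->|n2] := eqVneq j i2; first by right.
by move: n12; rewrite (f_inj i1 i2) ?eqxx // !inE eq_sym.
Qed.

(* Exactly two colours [i1 != i2] have the same minimiser over [P], and each of
   them accounts for one extension: the greatest [z] in its order among the
   points that exceed the minimum of [P] in all the other orders. *)
Lemma card_dominant_extensions (T K : finType) (r : K -> T -> nat)
    (P : {set T}) :
    (forall i, injective (r i)) -> dominant r P -> #|P|.+1 = #|K| ->
    (0 < #|P|) ->
    (forall i j p, i != j -> p \in P ->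
        (forall x, x \in P -> r i p <= r i x) ->
        (forall x, x \in P -> r j p <= r j x) ->
      exists y, forall k, k != j -> exists2 x, x \in P & r k x < r k y) ->
  #|[set z | (z \notin P) && dominant r (z |: P)]| = 2.
Proof.
move=> r_inj domP cP /card_gt0P[x0 x0P] ext.
pose mn i := [arg min_(x < x0 in P) r i x].
have mnP i : mn i \in P by rewrite /mn; case: arg_minnP.
have mn_le i x : x \in P -> r i (mn i) <= r i x.
  by rewrite /mn; case: arg_minnP => // y _; apply.
have mn_uniq i x : x \in P -> (forall z, z \in P -> r i x <= r i z) -> x = mn i.
  by move=> xP le_x; apply: (r_inj i); apply/eqP; rewrite eqn_leq le_x // mn_le.
have mn_surj : mn @: setT = P.
  apply/setP => x; apply/imsetP/idP => [[i _ ->] // | xP].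
  by have /dominantP/(_ x)[i le_x] := domP; exists i => //; apply: mn_uniq.
have [i1 [i2 [n12 e12 coll]]] := surjection_collision mn_surj cP.
pose U j y := [forall (k | k != j), r k (mn k) < r k y].
have UP j y : reflect (forall k, k != j -> r k (mn k) < r k y) (U j y).
  exact: forall_inP.
(* [ext] is used with the other colliding colour as [i], since both share a minimiser; it makes the
   set maximised over in [top] nonempty. *)
have exU j : j = i1 \/ j = i2 -> exists y, U j y.
  move=> j12.
  have [i [nij emn]] : exists i, i != j /\ mn i = mn j.
    by case: j12 => ->; [exists i2; rewrite eq_sym | exists i1].
  have [] := ext i j (mn i) nij (mnP i) (mn_le i).
    by rewrite emn; apply: mn_le.
  move=> y Hy; exists y; apply/UP => k /Hy[x xP lt_xy].
  exact: leq_ltn_trans (mn_le k x xP) lt_xy.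
have top j : j = i1 \/ j = i2 ->
    exists2 z, U j z & forall y, U j y -> r j y <= r j z.
  move=> /exU[y0 Uy0]; exists [arg max_(y > y0 | U j y) r j y];
    by case: arg_maxnP => // z _; apply.
have [z1 Uz1 z1max] := top i1 (or_introl erefl).
have [z2 Uz2 z2max] := top i2 (or_intror erefl).
have notin j z : j = i1 \/ j = i2 -> U j z -> z \notin P.
  move=> j12 /UP Uz; apply/negP; rewrite -mn_surj => /imsetP[i _ ez].
  have [eij|nij] := eqVneq i j; last by have := Uz i nij; rewrite ez ltnn.
  move: ez; rewrite {i}eij; case: j12 Uz => -> Uz ez.
    by have := Uz i2; rewrite eq_sym n12 ez e12 ltnn => /(_ isT).
  by have := Uz i1; rewrite n12 ez e12 ltnn => /(_ isT).
have dom_top j z : U j z -> (forall y, U j y -> r j y <= r j z) ->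
    dominant r (z |: P).
  move=> Uz zmax; apply/dominantP => y.
  have [/zmax le_yz|/forall_inPn[k nkj]] := boolP (U j y); last first.
    rewrite -leqNgt => le_yk; exists k => x /setU1P[->|/(mn_le k)].
      by apply: leq_trans le_yk _; apply: ltnW; move/UP: Uz => ->.
    exact: leq_trans le_yk.
  have /dominantP/(_ y)[i le_y] := domP.
  have [eij|nij] := eqVneq i j.
    by exists j => x /setU1P[->//|]; rewrite -eij; apply: le_y.
  exists i => x /setU1P[->|/le_y //].
  apply: leq_trans (le_y _ (mnP i)) _.
  by apply: ltnW; move/UP: Uz => ->.
(* A common point would exceed the minimum of [P] in every order, against the dominance of [P]. *)
have n_z12 : z1 != z2.
  apply/eqP => ez; have /dominantP/(_ z1)[i le_z1] := domP.
  have := le_z1 _ (mnP i); apply/negP; rewrite -ltnNge.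
  have [ei|ni] := eqVneq i i1; last by move/UP: Uz1 => ->.
  by move/UP: Uz2; rewrite -ez ei => ->.
have -> : [set z | (z \notin P) && dominant r (z |: P)] = [set z1; z2].
  apply/setP => z; rewrite !inE; apply/andP/orP; last first.
    by case=> /eqP->; split; [apply: notin Uz1 | apply: dom_top Uz1 _
      | apply: notin Uz2 | apply: dom_top Uz2 _]; auto.
  move=> [zP domz].
  have lem x : x \in z |: P ->
      exists i, forall w, w \in z |: P -> r i x <= r i w.
    by move: domz => /dominantP/(_ x)[i le_x] _; exists i.
  have [j le_z] := lem z (setU11 _ _).
  have Ujz : U j z /\ {in [set~ j] &, injective mn}.
    (* the minimisation map K -> z |: P is a bijection, and only [j] hits z *)
    pose mz i := [arg min_(x < z in z |: P) r i x].
    have mzP i : mz i \in z |: P.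
      by rewrite /mz; case: arg_minnP => //; apply: setU11.
    have mz_le i x : x \in z |: P -> r i (mz i) <= r i x.
      by rewrite /mz; case: arg_minnP => [|y _]; [apply: setU11 | apply].
    have mz_uniq i x : (x \in z |: P) ->
        (forall w, w \in z |: P -> r i x <= r i w) -> x = mz i.
      move=> xP le_x; apply: (r_inj i); apply/eqP.
      by rewrite eqn_leq le_x // mz_le.
    have mz_surj : mz @: setT = z |: P.
      apply/setP => x; apply/imsetP/idP => [[i _ ->] // | xP].
      by have [i le_x] := lem x xP; exists i => //; apply: mz_uniq.
    have mz_inj : injective mz.
      have mz_injT : {in setT &, injective mz}.
        by apply/imset_injP; rewrite mz_surj cardsU1 zP cardsT add1n cP.
      by move=> i k; apply: mz_injT.
    have ezj : z = mz j by apply: mz_uniq => //; apply: setU11.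
    have emz i : i != j -> mz i = mn i.
      move=> nij; apply: mn_uniq => [|x xP]; last by apply/mz_le/setU1r.
      case/setU1P: (mzP i) => // ez; move: nij.
      by rewrite (mz_inj i j) ?eqxx // ez.
    split; last first.
      by move=> i k; rewrite !inE => ni nk; rewrite -!emz //; apply: mz_inj.
    apply/UP => i nij; rewrite ltn_neqAle -emz // mz_le ?setU11 // andbT.
    apply: contra nij => /eqP/r_inj ez; apply/eqP; apply: mz_inj.
    by rewrite ez.
  have [Uz /coll j12] := Ujz.
  have zmax y : U j y -> r j y <= r j z.
    move=> /UP Uy; have /dominantP/(_ y)[i le_y] := domz.
    have [<-|nij] := eqVneq i j; first by apply: le_y; apply: setU11.
    by have := le_y _ (setU1r _ (mnP i)); rewrite leqNgt Uy.
  case: j12 => ej; rewrite ej in Uz zmax *.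
    by left; apply/eqP/(r_inj i1)/eqP; rewrite eqn_leq zmax // z1max.
  by right; apply/eqP/(r_inj i2)/eqP; rewrite eqn_leq zmax // z2max.
by rewrite cards2 n_z12.
Qed.

(** If [S] carries all colours, only its point of colour [i0] can be removed. Otherwise a removable
    [z] has a colour other than [i0] that recurs at a unique [w], and exactly [z] and [w] are
    removable: the count is 0 or 2. *)
Lemma card_near_rainbow_facets (T K : finType) (c : T -> K) (i0 : K)
    (S : {set T}) :
  #|S| = #|K| ->
  odd #|[set z in S | c @: (S :\ z) == [set~ i0]]| = (c @: S == setT).
Proof.
move=> cS; have [eS|nS] := eqVneq (c @: S) setT.
  have c_inj : {in S &, injective c}.
    by apply/imset_injP; rewrite eS cardsT cS.
  have /imsetP[z zS ez] : i0 \in c @: S by rewrite eS inE.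
  suff -> : [set z in S | c @: (S :\ z) == [set~ i0]] = [set z].
    by rewrite cards1.
  apply/setP => w; rewrite !inE; apply/andP/eqP => [[wS /eqP e]|->].
    apply/eqP; apply: contraT => nwz.
    have : i0 \in [set~ i0] 
      by rewrite -e ez; apply: imset_f; rewrite !inE eq_sym nwz.
    by rewrite !inE eqxx.
  split=> //; apply/eqP/setP => k; rewrite !inE; apply/imsetP/idP.
    move=> [x]; rewrite !inE => /andP[nx xS] ->; apply: contra nx => /eqP e.
    by apply/eqP/c_inj => //; rewrite e ez.
  move=> nk; have /imsetP[x xS ek] : k \in c @: S by rewrite eS inE.
  exists x => //; rewrite !inE xS andbT; apply: contra nk => /eqP e.
  by rewrite ek e ez.
have [->|/set0Pn[z]] := eqVneq [set z in S | c @: (S :\ z) == [set~ i0]] set0.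
  by rewrite cards0.
rewrite !inE => /andP[zS /eqP ez].
have c_inj : {in S :\ z &, injective c}.
  apply/imset_injP; by rewrite ez cardsC1 -cS (cardsD1 z S) zS.
have ncz : c z != i0.
  apply: contra nS => /eqP e; rewrite -(setD1K zS) imsetU1 ez e.
  by apply/eqP/setP => k; rewrite !inE orbN.
have /imsetP[w wS ew] : c z \in c @: (S :\ z) by rewrite ez !inE.
move: (wS); rewrite !inE => /andP[nwz wS'].
suff -> : [set z in S | c @: (S :\ z) == [set~ i0]] = [set z; w].
  by rewrite cards2 eq_sym nwz.
apply/setP => v; rewrite !inE; apply/andP/orP => [[vS /eqP ev]|].
  apply/orP; apply: contraT; rewrite negb_or => /andP[nvz nvw].
  have : c v \in c @: (S :\ v).
    by rewrite ev -ez; apply: imset_f; rewrite !inE nvz.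
  move=> /imsetP[u]; rewrite !inE => /andP[nuv uS] e.
  have vSz : v \in S :\ z by rewrite !inE nvz.
  have [euz|nuz] := eqVneq u z.
    have /(c_inj _ _ vSz wS) e' : c v = c w by rewrite e euz.
    by rewrite e' eqxx in nvw.
  by move: nuv; rewrite (c_inj v u) ?eqxx // !inE nuz.
case=> /eqP->; first by rewrite zS ez eqxx.
split=> //; apply/eqP; rewrite -ez; apply/setP => k.
apply/imsetP/imsetP => -[x]; rewrite !inE => /andP[nx xS] ->.
  have [->|nxz] := eqVneq x z; first by exists w.
  by exists x => //; rewrite !inE nxz.
have [->|nxw] := eqVneq x w; first by exists z => //; rewrite !inE eq_sym nwz.
by exists x => //; rewrite !inE nxw.
Qed.

(** Both sides count the incidences [S = z |: P], [P = S :\ z], grouped by [P] or by [S]. *)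
Lemma double_count_extensions (T : finType) (A B : pred {set T}) :
  \sum_(P | A P) #|[set z | (z \notin P) && B (z |: P)]| =
  \sum_(S | B S) #|[set z in S | A (S :\ z)]|.
Proof.
under eq_bigr => P _ do rewrite -sum1dep_card.
under [RHS]eq_bigr => S _ do rewrite -sum1dep_card.
rewrite !pair_big_dep /=.
rewrite (reindex_onto (fun q : {set T} * T => (q.1 :\ q.2, q.2))
                      (fun p => (p.2 |: p.1, p.2))) /=; last first.
  by move=> [P z] /= /and3P[_ zP _]; rewrite setU1K.
apply: eq_bigl => -[S z] /=; rewrite !inE eqxx /= xpair_eqE eqxx andbT.
have [zS|zS] := boolP (z \in S); first by rewrite setD1K // eqxx andbT andbC.
rewrite /= andbF; apply/negbTE/negP => /andP[_ /eqP e].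
by rewrite -e setU11 in zS.
Qed.

Section Scarf.
Variables (T K : finType) (r : K -> T -> nat) (c : T -> K).
Hypothesis r_inj : forall i, injective (r i).

(* [inl i] is the least element for the order [i] and lies above all of [T]
   for the other orders *)
Definition slack_rank (i : K) (z : K + T) : nat :=
  match z with
  | inl k => if k == i then 0
             else (\max_i \max_x r i x).+2 + enum_rank k
  | inr x => (r i x).+1
  end.

Definition slack_color (z : K + T) : K :=
  match z with inl k => k | inr x => c x end.

(** Real ranks are shifted by one to keep 0 for the least slack, so they reach at most the maximum
    plus one; hence the offset [.+2]. *)
Lemma slack_rank_lt (i k : K) (x : T) :
  k != i -> slack_rank i (inr x) < slack_rank i (inl k).
Proof.
move=> /negbTE /= ->; apply: leq_trans (leq_addr _ _); rewrite !ltnS.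
exact: leq_trans (leq_bigmax x) (leq_bigmax i).
Qed.

Lemma slack_rank_inj (i : K) : injective (slack_rank i).
Proof.
have lt := @slack_rank_lt i.
case=> [k|x] [l|y] e.
- congr inl; move: e => /=.
  have [->|nk] := eqVneq k i; have [->|nl] := eqVneq l i => //.
  by move=> /addnI/ord_inj/enum_rank_inj.
- have [ek|nk] := eqVneq k i; first by move: e; rewrite /= ek eqxx.
  by have := lt _ y nk; rewrite e ltnn.
- have [el|nl] := eqVneq l i; first by move: e; rewrite /= el eqxx.
  by have := lt _ x nl; rewrite e ltnn.
by case: e => /r_inj ->.
Qed.

(* Parity argument: a door is a facet carrying all colours but [i0].  Every door
   lies in an even number of rooms, except the one made of slacks, and a room
   has an odd number of doors exactly when it carries all the colours. *)
Lemma scarf (x0 : T) :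
  exists s : {set T}, forall y, exists2 i, i \in c @: s &
    forall x, x \in s -> r i y <= r i x.
Proof.
pose i0 := c x0.
pose door (P : {set K + T}) :=
  (#|P|.+1 == #|K|) && (slack_color @: P == [set~ i0]).
pose room (S : {set K + T}) := (#|S| == #|K|) && dominant slack_rank S.
have cardC : #|[set~ i0]|.+1 = #|K|.
  by rewrite cardsC1 prednK //; apply/card_gt0P; exists i0.
pose P0 : {set K + T} := inl @: [set~ i0].
have door0 : door P0.
  rewrite /door card_imset ?cardC ?eqxx /=; last by move=> ? ? [].
  by rewrite -imset_comp imset_id.
have P0inl k : (inl k \in P0) = (k != i0).
  by rewrite mem_imset ?inE // => ? ? [].
have P0inr x : inr x \notin P0 by apply/negP => /imsetP[].
(* Only the point greatest for [i0] completes [P0]: adding [inl i0] yields all slacks, whose minimum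
   is 0 in every order and is exceeded by any real point. *)
have odd0 : #|[set z | (z \notin P0) && room (z |: P0)]| = 1.
  pose t := [arg max_(x > x0) r i0 x].
  have tmax x : r i0 x <= r i0 t.
    by rewrite /t; case: arg_maxnP => // ? _; apply.
  apply/eqP/cards1P; exists (inr t); apply/setP => z; rewrite !inE.
  apply/andP/eqP => [[zP /andP[_ /dominantP domz]]|->].
    case: z zP domz => [k|x] zP domz.
      move: zP domz; rewrite P0inl negbK => /eqP-> /(_ (inr x0))[i].
      have iS : inl i \in inl i0 |: P0.
        rewrite in_setU1 P0inl.
        by case: (eqVneq i i0) => [->|]; rewrite ?eqxx ?orbT.
      by move=> /(_ _ iS); rewrite /= eqxx.
    have [i le_t] := domz (inr t); congr inr.
    have ei : i = i0.
      apply/eqP; apply: contraT; rewrite -P0inl => iP.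
      by have := le_t _ (setU1r _ iP); rewrite /= eqxx.
    apply: (r_inj (i := i0)); apply/eqP; rewrite eqn_leq tmax /=.
    by have := le_t _ (setU11 _ _); rewrite ei.
  split=> //; rewrite /room cardsU1 P0inr add1n; case/andP: door0 => -> _ /=.
  apply/dominantP => -[k|x]; first by exists k => ? _; rewrite /= eqxx.
  exists i0 => w /setU1P[->|]; first exact: tmax.
  case: w => [k|y]; first by rewrite P0inl => /slack_rank_lt/ltnW.
  by rewrite (negbTE (P0inr y)).
have even P : door P -> P != P0 ->
    ~~ odd #|[set z | (z \notin P) && room (z |: P)]|.
  move=> /andP[/eqP cP /eqP colP] nP0.
  (* A door without real points is [P0], because slacks are their own colours. *)
  have [x xP] : exists x, inr x \in P.
    apply/existsP; apply: contraR nP0 => /existsPn noreal.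
    apply/eqP/setP => -[k|x]; last first.
      by rewrite (negbTE (noreal x)) (negbTE (P0inr x)).
    rewrite P0inl; have <- : (k \in [set~ i0]) = (k != i0) by rewrite !inE.
    rewrite -colP; apply/idP/imsetP => [kP|[[l|y] zP ->] //].
      by exists (inl k).
    by have := noreal y; rewrite zP.
  have -> : [set z | (z \notin P) && room (z |: P)] =
      [set z | (z \notin P) && dominant slack_rank (z |: P)].
    apply/setP => z; rewrite !inE /room cardsU1.
    by case: (z \in P); rewrite //= add1n cP eqxx.
  have [domP|ndomP] := boolP (dominant slack_rank P); last first.
    rewrite (_ : [set z | _] = set0) ?cards0 //; apply/setP => z; rewrite !inE.
    apply/negbTE/negP => /andP[_]; apply/negP; apply: contra ndomP.
    by apply: dominantS; apply: subsetUr.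
  rewrite card_dominant_extensions //.
  - exact: slack_rank_inj.
  - by apply/card_gt0P; exists (inr x).
  (* A slack is not minimal in two orders, since the real [x] lies below it in all orders but its
     own. For a real [p], the slack of [j] is the required [y]. *)
  move=> i j [k|p] nij pP le_i le_j.
    have [ei|/slack_rank_lt] := eqVneq k i; last first.
      by move=> /(_ x); rewrite ltnNge le_i.
    have [ej|/slack_rank_lt] := eqVneq k j; last first.
      by move=> /(_ x); rewrite ltnNge le_j.
    by rewrite -ei -ej eqxx in nij.
  exists (inl j) => k nkj; exists (inr x) => //.
  by apply: slack_rank_lt; rewrite eq_sym.
have : odd (\sum_(P | door P) #|[set z | (z \notin P) && room (z |: P)]|).
  rewrite (bigD1 P0) //= odd0 oddD /= (big_morph odd oddD (erefl _)).
  by rewrite big1 // => P /andP[dP nP]; apply/negbTE/even.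
rewrite double_count_extensions (big_morph odd oddD (erefl _)).
have [S /andP[/andP[/eqP cS domS] /eqP rbS] _|no] :=
    pickP [pred S | room S && (slack_color @: S == setT)]; last first.
  rewrite big1 // => S roomS; have /andP[/eqP cS _] := roomS.
  rewrite (eq_card (B := [set z in S | slack_color @: (S :\ z) == [set~ i0]])).
    rewrite card_near_rainbow_facets //; have := no S.
    by rewrite /= roomS.
  move=> z; rewrite !inE /door; case: (boolP (z \in S)) => //= zS.
  by rewrite -cS (cardsD1 z S) zS eqxx.
exists [set x | inr x \in S] => y; have /dominantP/(_ (inr y))[i le_y] := domS.
exists i; last by move=> x; rewrite inE => /le_y.
have /imsetP[[k|x] zS e] : i \in slack_color @: S by rewrite rbS inE.
  by move: (le_y _ zS); rewrite e /= eqxx.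
by rewrite e; apply: imset_f; rewrite inE.
Qed.

End Scarf.

(** * Nearby grid points with prescribed labels *)

(** Scarf's lemma for the coordinate orders gives a set [s]. Its coordinatewise minima, summed over
    the labels of [s], fall short of [N] by less than the number of labels. So points of [s] differ
    by at most [#|K|] in each coordinate, and a coordinate above [#|K|] belongs to a label. *)
Lemma grid_sperner (K : finType) (k0 : K) (N : nat)
    (c : {ffun K -> 'I_N.+1} -> K) :
  exists2 x : {ffun K -> 'I_N.+1}, \sum_i x i = N &
    forall i, #|K| < x i ->
      exists z : {ffun K -> 'I_N.+1}, [/\ \sum_i z i = N, c z = i &
        forall j, x j <= z j + #|K| /\ z j <= x j + #|K|].
Proof.
pose T : finType := {x : {ffun K -> 'I_N.+1} | \sum_i x i == N}.
have mkT (f : K -> nat) : \sum_i f i = N ->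
    exists x : T, forall i, val x i = f i :> nat.
  move=> sf; have lef i : f i < N.+1 by rewrite ltnS -sf (bigD1 i) //= leq_addr.
  have sx : \sum_i [ffun i => Ordinal (lef i)] i == N.
    by under eq_bigr do rewrite ffunE; apply/eqP.
  by exists (Sub [ffun i => Ordinal (lef i)] sx) => i; rewrite SubK ffunE.
have sumT (x : T) : \sum_i val x i = N by apply/eqP/(valP x).
(* The coordinate is the leading digit in base [#|T|]; the enumeration of [T] breaks ties. *)
pose r i (x : T) : nat := val x i * #|T| + enum_rank x.
have r_inj i : injective (r i).
  move=> x y /(congr1 (modn^~ #|T|)); rewrite !modnMDl !modn_small //.
  by move/ord_inj/enum_rank_inj.
have r_le i y x : r i y <= r i x -> val y i <= val x i.
  apply: contraTT; rewrite -!ltnNge => lt_xy.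
  have lt_r : r i x < (val x i).+1 * #|T| by rewrite mulSnr ltn_add2l.
  apply: leq_trans lt_r (leq_trans _ (leq_addr _ _)).
  by rewrite leq_mul2r lt_xy orbT.
have [x0 _] : exists x : T,
    forall i, val x i = (if i == k0 then N else 0) :> nat.
  by apply: mkT; rewrite -big_mkcond big_pred1_eq.
have [s dom_s] := scarf (c \o val) r_inj x0.
set C := _ @: s in dom_s.
have [i1 i1C _] := dom_s x0.
have /imsetP[w0 w0s _] := i1C.
pose m i : nat := val [arg min_(x < w0 in s) val x i] i.
have m_le i x : x \in s -> m i <= val x i.
  by rewrite /m; case: arg_minnP => // y _; apply.
have mE i : exists2 x, x \in s & m i = val x i.
  by rewrite /m; case: arg_minnP => // y ys _; exists y.
have big_m : N < \sum_(i in C) (m i).+1.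
  rewrite ltnNge; apply/negP => le_m.
  (* There would be room for a grid point exceeding [m] at every label, against the choice of [s];
     the remaining mass goes to the label [i1]. *)
  pose f i := (if i \in C then (m i).+1 else 0) +
    (if i == i1 then N - \sum_(i in C) (m i).+1 else 0).
  have [] := mkT f.
    by rewrite big_split /= -!big_mkcond /= big_pred1_eq subnKC.
  move=> y yE; have [i iC le_y] := dom_s y.
  have [x xs mx] := mE i; have := r_le _ _ _ (le_y _ xs).
  by rewrite yE /f iC -mx addSn ltnNge leq_addr.
(* Taking 0 off the labels bounds the coordinates there by [#|K|], so a larger coordinate must be a
   label. *)
pose m' i := if i \in C then m i else 0.
have m'_le i x : x \in s -> m' i <= val x i.
  by rewrite /m'; case: ifP => // _; apply: m_le.
have le_m' i x : x \in s -> val x i <= m' i + #|K|.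
  move=> xs; rewrite -leq_subLR.
  have : \sum_i (val x i - m' i) <= #|K|.
    rewrite sumnB => [|j _]; last exact: m'_le.
    rewrite sumT leq_subLR -big_mkcond /=.
    apply: leq_trans (ltnW big_m) _.
    under eq_bigr do rewrite -addn1.
    by rewrite big_split /= leq_add2l sum1_card max_card.
  by apply: leq_trans; rewrite (bigD1 i) //= leq_addr.
exists (val w0) => // i lt_i.
have /imsetP[z zs ei] : i \in C.
  by apply: contraLR lt_i => /negbTE nC; rewrite -leqNgt;
    have := le_m' i _ w0s; rewrite /m' nC.
exists (val z); split=> // j; split.
  by apply: leq_trans (le_m' _ _ w0s) _; rewrite leq_add2r m'_le.
by apply: leq_trans (le_m' _ _ zs) _; rewrite leq_add2r m'_le.
Qed.

Import Order.TTheory GRing.Theory Num.Theory.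
Import numFieldNormedType.Exports.
Local Open Scope ring_scope.
Local Open Scope classical_set_scope.

(** * The variational inequality on the simplex *)

Definition simplex (R : realType) (k : nat) : set 'rV[R]_k :=
  [set x | (forall i, 0 <= x 0 i) /\ \sum_i x 0 i = 1].

Lemma simplex_le1 (R : realType) (k : nat) (x : 'rV[R]_k) (i : 'I_k) :
  simplex x -> x 0 i <= 1.
Proof.
by move=> [x0 <-]; rewrite (bigD1 i) //= lerDl sumr_ge0.
Qed.

Lemma continuous_sum (R : realType) (T : topologicalType) (I : Type)
    (s : seq I) (P : pred I) (f : I -> T -> R) :
  (forall i, P i -> continuous (f i)) ->
  continuous (fun x => \sum_(i <- s | P i) f i x).
Proof. by apply: continuous_big => x; apply: add_continuous. Qed.

Lemma continuous_prod (R : realType) (T : topologicalType) (I : Type)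
    (s : seq I) (P : pred I) (f : I -> T -> R) :
  (forall i, P i -> continuous (f i)) ->
  continuous (fun x => \prod_(i <- s | P i) f i x).
Proof. by apply: continuous_big => x; apply: mul_continuous. Qed.

Lemma simplex_compact (R : realType) (k : nat) : compact (@simplex R k).
Proof.
have box : compact [set x : 'rV[R]_k | forall i, `[0, 1]%classic (x ord0 i)].
  apply: (@rV_compact _ _ (fun=> `[(0 : R), 1]%classic)) => _.
  exact: segment_compact.
apply: (subclosed_compact _ box) => [|x xS i]; last first.
  by rewrite /= in_itv /= simplex_le1 // xS.1.
have -> : @simplex R k = (\bigcap_i [set x : 'rV[R]_k | 0 <= x 0 i]) `&`
    (fun x : 'rV[R]_k => \sum_i x 0 i) @^-1` [set 1].
  by apply/seteqP; split=> x [x0 x1]; split=> // i; [move=> _|]; apply: x0.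
apply: closedI.
  apply: closed_bigI => i _.
  have /continuous_closedP/(_ _ (@closed_ge R 0)) :
    continuous (fun x : 'rV[R]_k => x 0 i) by apply: coord_continuous.
  exact.
have /continuous_closedP/(_ _ (@closed_eq R 1)) :
  continuous (fun x : 'rV[R]_k => \sum_i x 0 i).
  by apply: continuous_sum => i _; apply: coord_continuous.
exact.
Qed.

(** A cluster point replaces the limit of a subsequence: visits to each neighbourhood at arbitrarily
    late indices suffice to refute an open condition. *)
Lemma compact_seq_cluster (T : topologicalType) (K : set T) (u : nat -> T) :
  compact K -> (forall n, K (u n)) ->
  exists2 p, K p &
    forall (A : set T) (n0 : nat), nbhs p A -> exists2 n, (n0 <= n)%N & A (u n).
Proof.
move=> cK uK.
have [|p [Kp clp]] := cK (u @ \oo) _; first by exists 0%N => // n _; apply: uK.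
exists p => // A n0 pA.
have [|_ [[n n0n <-] An]] := clp (u @` [set n | (n0 <= n)%N]) A _ pA.
  by exists n0 => // n /= n0n; exists n.
by exists n.
Qed.

Lemma continuous_nbhs_gt (R : realType) (T : topologicalType) (f : T -> R)
    (p : T) (y : R) :
  continuous f -> y < f p -> nbhs p [set z | y < f z].
Proof. by move=> f_cont lt_y; apply: (cvgr_gt _ (f_cont p)). Qed.

(** Since [x] is carried by minimal components of [F x], the sum of [F i x * (y 0 i - x 0 i)] is
    nonnegative for every [y] in the simplex: this is the variational inequality. *)
Lemma simplex_variational_inequality (R : realType) (k : nat)
    (F : 'I_k.+1 -> 'rV[R]_k.+1 -> R) :
  (forall i, continuous (F i)) ->
  exists2 x, simplex x & forall i j, 0 < x 0 i -> F i x <= F j x.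
Proof.
move=> F_cont.
(* Grid coordinates are multiples of [1 / N.+1], and [grid_sperner] allows [k.+1] steps of
   discrepancy. *)
pose e N : R := k.+1%:R / N.+1%:R.
have approx N : exists x : 'rV[R]_k.+1, simplex x /\
    forall i, e N < x 0 i -> exists z, (forall j, F i z <= F j z) /\
      forall j, `|x 0 j - z 0 j| <= e N.
  pose pt (z : {ffun 'I_k.+1 -> 'I_N.+2}) : 'rV[R]_k.+1 :=
    \row_i ((z i)%:R / N.+1%:R).
  pose c z : 'I_k.+1 := [arg min_(i < ord0) F i (pt z)]%O.
  have cP z j : F (c z) (pt z) <= F j (pt z).
    by rewrite /c; case: arg_minP => // i _; apply.
  have N0 : (0 : R) < N.+1%:R^-1 by rewrite invr_gt0 ltr0n.
  have [x sx xP] := grid_sperner ord0 c.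
  exists (pt x); split.
    split=> [i|]; first by rewrite mxE mulr_ge0 // ltW.
    under eq_bigr do rewrite mxE.
    by rewrite -mulr_suml -natr_sum sx divff // pnatr_eq0.
  move=> i; rewrite mxE /e ltr_pM2r // ltr_nat -[X in (X < _)%N]card_ord.
  move=> /xP[z [_ <- close]]; exists (pt z); split; first exact: cP.
  move=> j; have [le1 le2] := close j; rewrite card_ord in le1 le2.
  rewrite !mxE -mulrBl normrM (gtr0_norm N0) ler_pM2r //.
  by rewrite ler_distl lerBlDr -!natrD !ler_nat le1 le2.
have [u uP] := choice approx.
have [p pS clp] := compact_seq_cluster (@simplex_compact R k.+1)
  (fun N => (uP N).1).
exists p => // i j pi0; rewrite leNgt; apply/negP => ltF.
have : nbhs p [set z | 0 < F i z - F j z /\ p 0 i / 2 < z 0 i].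
  apply: filterI.
    apply: continuous_nbhs_gt; last by rewrite subr_gt0.
    by move=> z; apply: cvgB (F_cont i z) (F_cont j z).
  apply: (continuous_nbhs_gt (f := fun z : 'rV[R]_k.+1 => z 0 i)).
    exact: coord_continuous.
  by rewrite gtr_pMr // invf_lt1 // ltr1n.
move=> /nbhs_ballP[d /= d0 ball_d].
(* The bound [p 0 i / 2] makes label [i] occur near [u N]; [d / 2] keeps the point with that label
   within [d] of [p], where [F i] is not minimal. *)
have [M eM] : exists M, forall N,
    (M <= N)%N -> e N < Num.min (d / 2) (p 0 i / 2).
  have m0 : 0 < Num.min (d / 2) (p 0 i / 2) by rewrite lt_min !divr_gt0.
  pose y := k.+1%:R / Num.min (d / 2) (p 0 i / 2).
  have y0 : 0 <= y by rewrite divr_ge0 // ltW.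
  exists (Num.bound y) => N leN.
  rewrite /e ltr_pdivrMr // mulrC -ltr_pdivrMr //.
  by apply: lt_le_trans (archi_boundP y0) _; rewrite ler_nat leqW.
have [N leN uN] : exists2 N, (M <= N)%N & ball p (d / 2) (u N).
  by apply: clp; apply: nbhsx_ballx; rewrite divr_gt0.
have := eM _ leN; rewrite lt_min => /andP[e1 e2].
have [|z [zmin zclose]] := (uP N).2 i.
  apply: lt_trans e2 _.
  apply: (ball_d (u N) _).2.
  by apply: le_ball uN; rewrite ler_pdivrMr // ler_peMr ?ler1n // ltW.
have [] : 0 < F i z - F j z /\ p 0 i / 2 < z 0 i.
  apply: ball_d; rewrite [d]splitr; apply: ball_triangle uN _.
  split; first by rewrite divr_gt0.
  by move=> a b; rewrite ord1; apply: le_lt_trans (zclose b) e1.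
by rewrite subr_gt0 ltNge zmin.
Qed.

(** * Tensor complementarity problems *)

Lemma tensor_applyZ (R : realType) (m n : nat) (A : tensor R m n) (a : R)
    (x : 'cV[R]_n) :
  tensor_apply A (a *: x) = a ^+ m.-1 *: tensor_apply A x.
Proof.
apply/colP => i; rewrite !mxE mulr_sumr; apply: eq_bigr => t _.
under eq_bigr do rewrite mxE.
rewrite big_split /= big_const_seq count_predT iter_mulr_1.
by rewrite size_behead size_tuple mulrCA.
Qed.

Lemma tensor_apply_continuous (R : realType) (m n : nat) (A : tensor R m n)
    (T : topologicalType) (f : T -> 'cV[R]_n) (i : 'I_n) :
  (forall j, continuous (fun z => f z j 0)) ->
  continuous (fun z => tensor_apply A (f z) i 0).
Proof.
move=> f_cont.
have -> : (fun z => tensor_apply A (f z) i 0) =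
    fun z => \sum_(t : m.-tuple 'I_n | ohead t == Some i)
               A t * \prod_(j <- behead t) f z j 0.
  by apply: funext => z; rewrite mxE.
apply: continuous_sum => t _ z.
by apply: cvgMl_tmp; apply: continuous_prod => j _; apply: f_cont.
Qed.

Definition drop_slack (R : realType) (n : nat) (z : 'rV[R]_n.+1) : 'cV[R]_n :=
  \col_i z 0 (lift ord0 i).

Lemma drop_slack_continuous (R : realType) (n : nat) (j : 'I_n) :
  continuous (fun z : 'rV[R]_n.+1 => drop_slack z j 0).
Proof.
have -> : (fun z : 'rV[R]_n.+1 => drop_slack z j 0) =
    fun z => z 0 (lift ord0 j).
  by apply: funext => z; rewrite mxE.
exact: coord_continuous.
Qed.

(** Complementarity is asked as the one-sided bound that the variational inequality supplies; with
    the opposite sign condition each product vanishes. *)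
Lemma tcp_solution_coordE (R : realType) (m n : nat) (q : 'cV[R]_n)
    (A : tensor R m n) (x : 'cV[R]_n) :
  (forall i, 0 <= x i 0) ->
  (forall i, 0 <= (q + tensor_apply A x) i 0) ->
  (forall i, 0 < x i 0 -> (q + tensor_apply A x) i 0 <= 0) ->
  tcp_solution q A x.
Proof.
move=> x0 F0 comp; split=> //; apply/matrixP => a b; rewrite !ord1 mxE [RHS]mxE.
rewrite big1 // => i _; rewrite [x^T _ _]mxE.
have := x0 i; rewrite le_eqVlt => /predU1P[<-|xi]; first by rewrite mul0r.
have -> : (q + tensor_apply A x) i 0 = 0.
  by apply/eqP; rewrite eq_le comp // F0.
by rewrite mulr0.
Qed.

(* Coordinate [ord0] of [z] is the slack [1 - sum x] of the constraint
   [sum x <= 1]; the map [F] vanishes there. *)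
Lemma tcp_solution_or_blocked (R : realType) (m n : nat) (q : 'cV[R]_n)
    (A : tensor R m n) (r : R) : 0 < r ->
  (exists x, tcp_solution q A x) \/
  exists z : 'rV[R]_n.+1, [/\ simplex z, z 0 ord0 = 0 &
    forall k, 0 < drop_slack z k 0 ->
      q k 0 + r ^+ m.-1 * tensor_apply A (drop_slack z) k 0 <= 0].
Proof.
move=> r0.
pose F (i : 'I_n.+1) (z : 'rV[R]_n.+1) : R :=
  if unlift ord0 i is Some j
  then q j 0 + r ^+ m.-1 * tensor_apply A (drop_slack z) j 0 else 0.
have F_cont i : continuous (F i).
  rewrite /F; case: unliftP => [j _|_]; last exact: cst_continuous.
  have A_cont : continuous (fun z => tensor_apply A (drop_slack z) j 0).
    by apply: tensor_apply_continuous => l; apply: drop_slack_continuous.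
  by move=> z; apply: cvgD (cvg_cst _) (cvgMl_tmp (A_cont z)).
have F0 z : F ord0 z = 0 by rewrite /F unlift_none.
have FS z k : F (lift ord0 k) z =
    q k 0 + r ^+ m.-1 * tensor_apply A (drop_slack z) k 0.
  by rewrite /F liftK.
have [z [z_ge0 z1] zP] := simplex_variational_inequality F_cont.
have F_le0 k : 0 < drop_slack z k 0 ->
    q k 0 + r ^+ m.-1 * tensor_apply A (drop_slack z) k 0 <= 0.
  by rewrite mxE => zk; rewrite -FS -[leRHS](F0 z) zP.
have := z_ge0 ord0; rewrite le_eqVlt => /predU1P[z0|z0].
  by right; exists z.
(* A positive slack makes the value 0 of [F ord0] minimal, so all components of [F] are nonnegative;
   homogeneity turns them into [q + tensor_apply A x] at the rescaled point. *)
left; exists (r *: drop_slack z).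
have FE i : (q + tensor_apply A (r *: drop_slack z)) i 0 = F (lift ord0 i) z.
  by rewrite tensor_applyZ FS !mxE.
apply: tcp_solution_coordE => i.
- by rewrite !mxE mulr_ge0 // ltW.
- by rewrite FE -[leLHS](F0 z) zP.
- by rewrite FE FS mxE pmulr_rgt0 //; apply: F_le0.
Qed.

(** * Solvability for strictly semi-positive tensors and P-tensors *)

Lemma P_tensor_strictly_semi_positive (R : realType) (m n : nat)
    (A : tensor R m n) : P_tensor A -> strictly_semi_positive A.
Proof.
move=> PA x x0 /PA[i xi]; exists i.
have xi0 : 0 < x i 0.
  by rewrite lt0r x0 andbT; apply: contraTneq xi => ->; rewrite mul0r ltxx.
by split=> //; rewrite -(pmulr_rgt0 _ xi0).
Qed.

Lemma strictly_semi_positive_Q_tensor (R : realType) (m n : nat)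
    (A : tensor R m n) :
  (2 <= m)%N -> strictly_semi_positive A -> Q_tensor A.
Proof.
move=> m2 sspA q; apply: contrapT => nosol.
have /choice[u uP] N : exists z : 'rV[R]_n.+1, [/\ simplex z, z 0 ord0 = 0 &
    forall k, 0 < drop_slack z k 0 ->
      q k 0 + N.+1%:R ^+ m.-1 * tensor_apply A (drop_slack z) k 0 <= 0].
  by have [] := tcp_solution_or_blocked q A (ltr0Sn R N).
have uS N : simplex (u N) by have [] := uP N.
have [p [p_ge0 p1] clp] := compact_seq_cluster (@simplex_compact R n.+1) uS.
(* The vanishing slack passes to the cluster point, so the remaining coordinates of [p] sum to 1 and
   [drop_slack p] is nonzero. *)
have p0 : p 0 ord0 = 0.
  apply/eqP; rewrite eq_le p_ge0 andbT leNgt; apply/negP => p0.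
  have [] := clp [set z | 0 < z 0 ord0] 0%N.
    apply: (continuous_nbhs_gt (f := fun z : 'rV[R]_n.+1 => z 0 ord0)) p0.
    exact: coord_continuous.
  by move=> N _ /=; have [_ -> _] := uP N; rewrite ltxx.
have p'_ge0 : vec_ge0 (drop_slack p) by move=> i; rewrite mxE.
have p'_neq0 : drop_slack p <> 0.
  move=> p'0; move: p1; rewrite big_ord_recl p0 add0r big1 => [|i _].
    by move/eqP; rewrite eq_sym oner_eq0.
  by have /colP/(_ i) := p'0; rewrite !mxE.
have [k [pk Apk]] := sspA _ p'_ge0 p'_neq0.
(* Half the limit value is a positive lower bound that persists near [p]; a late index then makes
   [N.+1%:R * d] exceed the absolute value of [q k 0]. *)
pose d := tensor_apply A (drop_slack p) k 0 / 2.
have d0 : 0 < d by rewrite divr_gt0.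
have Ad : nbhs p [set z | 0 < drop_slack z k 0 /\
                          d < tensor_apply A (drop_slack z) k 0].
  apply: filterI.
    exact: continuous_nbhs_gt (@drop_slack_continuous R n k) pk.
  apply: (continuous_nbhs_gt (f := fun z => tensor_apply A (drop_slack z) k 0)).
    by apply: tensor_apply_continuous => j; apply: drop_slack_continuous.
  by rewrite /d gtr_pMr // invf_lt1 // ltr1n.
have [N leN [uk Auk]] := clp _ (Num.bound (`|q k 0| / d)) Ad.
have [_ _ /(_ k uk)] := uP N; apply/negP; rewrite -ltNge.
have lt_q : `|q k 0| < N.+1%:R * d.
  rewrite -ltr_pdivrMr //.
  apply: lt_le_trans (archi_boundP _) _; first by rewrite divr_ge0 // ltW.
  by rewrite ler_nat leqW.
(* Here [m2] enters: the exponent [m.-1] is at least 1, so the tensor term grows at least linearly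
   in [N.+1]. *)
have le_pow : N.+1%:R <= N.+1%:R ^+ m.-1 :> R.
  rewrite -[leLHS]expr1; apply: ler_weXn2l; first by rewrite ler1n.
  by rewrite -ltnS prednK // ltnW.
have le_A : N.+1%:R * d <=
    N.+1%:R ^+ m.-1 * tensor_apply A (drop_slack (u N)) k 0.
  by apply: ler_pM => //; apply: ltW.
rewrite -ltrBlDl sub0r; apply: lt_le_trans le_A.
by apply: le_lt_trans lt_q; rewrite -normrN ler_norm.
Qed.

Theorem corollary3p3 (R : realType) (m n : nat) (hm : (2 <= m)%N)
    (hn : (1 <= n)%N) (A : tensor R m n) :
  (strictly_semi_positive A -> Q_tensor A) /\ (P_tensor A -> Q_tensor A).
Proof.
split; first exact: strictly_semi_positive_Q_tensor.
by move/P_tensor_strictly_semi_positive; apply: strictly_semi_positive_Q_tensor.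
Qed.
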